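(* Let $G$ be a finite simple graph. (i) For every integer $k\ge 0$, let $a_k$ be the least $s$ such that Alice has a strategy guaranteeing a score of at most $s$, however Bob plays, in the variant of the ordering game on $G$ in which Alice is allowed to skip up to $k$ of her turns (at turns of her choice) and Bob may not skip. Then $\mathrm{gcol}(G)\le a_k$; that is, Alice cannot reduce the score by skipping any number of turns. (ii) For every integer $\ell\ge 0$, let $b_\ell$ be the least $s$ such that Alice has a strategy guaranteeing a score of at most $s$, however Bob plays, in the variant of the ordering game on $G$ in which Bob is allowed to skip up to $\ell$ of his turns (at turns of his choice) and Alice may not skip. Then $b_\ell\le \mathrm{gcol}(G)$; that is, Bob cannot increase the score by skipping any number of turns.
   Context: All graphs are finite and simple. For a linear ordering $\tau$ of all vertices of $G=(V,E)$ and $v\in V$, let $N_G^+(\tau,v)$ be the set of neighbors $u$ of $v$ in $G$ with $u<_\tau v$, let $N_G^+[\tau,v]=N_G^+(\tau,v)\cup\{v\}$, and let $\mathrm{col}(G,\tau)=\max_{v\in V}|N_G^+[\tau,v]|$ (taken to be $0$ if $V=\emptyset$). In the ordering game on $G$, Alice and Bob, with Alice moving first, alternately choose a not-yet-chosen vertex of $G$ and append it to the end of the current sequence (initially empty) until all vertices are listed, giving a linear ordering $\tau$ of $V$. The score is $\mathrm{col}(G,\tau)$; Alice tries to minimize it and Bob tries to maximize it. The game coloring number $\mathrm{gcol}(G)$ is the least $s$ such that Alice has a strategy guaranteeing a score of at most $s$ however Bob plays. To skip a turn means to choose no vertex on that turn, after which the other player has the next turn; the game still ends when all vertices have been chosen.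 *)

(* Defs.v *)
From mathcomp Require Import all_boot.
From mathcomp Require Import boolp.

Set Implicit Arguments.
Unset Strict Implicit.
Unset Printing Implicit Defensive.

(* A finite simple graph is a symmetric irreflexive relation [e] on a finite
   type [T].  A linear ordering tau of the vertices is the sequence listing
   them from first to last, so that u <_tau v iff [index u tau < index v tau]. *)

Definition Nplus (T : finType) (e : rel T) (tau : seq T) (v : T) : {set T} :=
  [set u | e v u & index u tau < index v tau].

Definition Nplus_closed (T : finType) (e : rel T) (tau : seq T) (v : T) :
  {set T} := v |: Nplus e tau v.

Definition col (T : finType) (e : rel T) (tau : seq T) : nat :=
  \max_(v : T) #|Nplus_closed e tau v|.

(* A history lists the outcomes of the turns so far, oldest first: [Some v] if
   the player chose [v], [None] if the player skipped.  Turns are numbered from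
   0; Alice has the even turns and Bob the odd ones. *)
Definition history (T : finType) : Type := seq (option T).

Definition bob_turn (T : finType) (h : history T) : bool := odd (size h).

Definition ordering (T : finType) (h : history T) : seq T := pmap id h.

Definition over (T : finType) (h : history T) : bool :=
  [forall v : T, v \in ordering h].

(* Number of turns skipped by Bob ([bob = true]) or Alice ([bob = false]). *)
Definition skips (T : finType) (bob : bool) (h : history T) : nat :=
  \sum_(i < size h | odd i == bob) (nth None h i == None).

(* Rules of the game in which Alice may skip up to [k] of her turns and Bob up
   to [l] of his. *)
Definition legal_move (T : finType) (k l : nat) (h : history T)
    (m : option T) : bool :=
  ~~ over h &&
  (if m is Some v then v \notin ordering h
   else skips (bob_turn h) h < (if bob_turn h then l else k)).

Definition legal_history (T : finType) (k l : nat) (h : history T) : Prop :=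
  forall i, i < size h -> legal_move k l (take i h) (nth None h i).

Definition alice_strategy (T : finType) (k l : nat)
    (sigma : history T -> option T) : Prop :=
  forall h, legal_history k l h -> ~~ over h -> ~~ bob_turn h ->
    legal_move k l h (sigma h).

Definition follows (T : finType) (sigma : history T -> option T)
    (h : history T) : Prop :=
  forall i, i < size h -> ~~ bob_turn (take i h) ->
    nth None h i = sigma (take i h).

Definition alice_guarantees (T : finType) (e : rel T) (k l s : nat) : Prop :=
  exists2 sigma : history T -> option T, alice_strategy k l sigma &
    forall h, legal_history k l h -> over h -> follows sigma h ->
      col e (ordering h) <= s.

Lemma alice_guarantees_card (T : finType) (e : rel T) (k l : nat) :
  alice_guarantees e k l #|T|.
Proof.
exists (fun h => [pick v | v \notin ordering h]) => [h _ nover _|h _ _ _].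
  rewrite /legal_move nover /=; case: pickP => // chosen.
  case/negP: nover; apply/forallP => v.
  by move/negbFE: (chosen v).
by apply/bigmax_leqP => v _; exact: max_card.
Qed.

Lemma ex_alice_guarantees (T : finType) (e : rel T) (k l : nat) :
  exists s, `[< alice_guarantees e k l s >].
Proof. by exists #|T|; apply/asboolP; exact: alice_guarantees_card. Qed.

(* The least score that Alice can guarantee. *)
Definition gcol_skip (T : finType) (e : rel T) (k l : nat) : nat :=
  ex_minn (ex_alice_guarantees e k l).

Definition gcol (T : finType) (e : rel T) : nat := gcol_skip e 0 0.

(* Main.v *)
Require Import Defs.
From mathcomp Require Import all_boot.
From mathcomp Require Import boolp.

(** Fix a target score [s].  Whether Alice can still reach it depends only on
    the set [M] of vertices listed so far and on the player to move, because
    listing [v] costs one more than the number of its neighbors in [M], in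
    whatever order these were listed.  [wins] is this recursion for the game
    without skips.

    The heart of the proof is that having to move never hurts Alice: if she
    wins from [M] with Bob to move, she wins from [M] when she moves herself
    ([wins_skip]).  Call a vertex safe if its degree is less than [s], so that
    it may be listed at any time.

    - A winning position with an unlisted vertex has a safe one
      ([wins_has_safe]): when the last vertex is listed, all its neighbors are
      already there, and still it meets the target.
    - Deleting a safe vertex [b] from the list of a winning position leaves a
      winning position with the same player to move
      ([wins_remove_safe_and_skip]).  Alice pretends that [b] is listed: this
      only makes the other vertices look more expensive.  If Bob lists [b], the
      pretence becomes true, with Alice to move where Bob would have been; this
      is a skip by Bob in a smaller position.
    - So if Alice wins from [M] with Bob to move, take a safe unlisted [b].
      Bob may list it, hence Alice wins from [b |: M] with the move, and
      deleting [b] again she wins from [M] with the move.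

    A skip of either player is now harmless: when Alice's strategy skips, she
    has a winning move instead, and when Bob skips, she has a winning move.
    Hence for all numbers of allowed skips Alice guarantees [s] exactly when
    she wins from the empty position ([guarantees_wins], [wins_guarantees]),
    and all the values [gcol_skip e k l] coincide. *)

Set Implicit Arguments.
Unset Strict Implicit.
Unset Printing Implicit Defensive.

(** * Positions of the game without skips *)

Section Positions.

Variables (T : finType) (e : rel T) (s : nat).
Implicit Types (M : {set T}) (v b : T).

Definition affordable M v : bool := #|[set u in M | e v u]| < s.

Definition safe v : bool := #|[set u | e v u]| < s.

(** The number [n] of moves left is the fuel of the recursion; it is meant to
    be the number of unlisted vertices, as in [wins]. *)
Fixpoint wins_in (n : nat) (bob : bool) M : bool :=
  if n is m.+1 then
    if bob then
      [forall (v | v \notin M), affordable M v && wins_in m false (v |: M)]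
    else [exists (v | v \notin M), affordable M v && wins_in m true (v |: M)]
  else true.

Definition wins (bob : bool) M : bool := wins_in #|~: M| bob M.

Lemma card_unlisted M v : v \notin M -> #|~: M| = #|~: (v |: M)|.+1.
Proof.
move=> vM; rewrite (cardsD1 v) inE vM add1n; congr _.+1.
by apply: eq_card => u; rewrite !inE negb_or.
Qed.

Lemma wins_setT bob : wins bob setT.
Proof. by rewrite /wins setCT cards0. Qed.

Lemma wins_bobP M :
  reflect (forall v, v \notin M -> affordable M v /\ wins false (v |: M))
          (wins true M).
Proof.
rewrite {2}/wins; case En: #|~: M| => [|n] /=.
  by apply: ReflectT => v /card_unlisted; rewrite En.
have E v : v \notin M -> #|~: (v |: M)| = n.
  by move/card_unlisted; rewrite En => -[].
apply: (iffP forall_inP) => W v vM; first by apply/andP; rewrite /wins E ?W.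
by apply/andP; rewrite -(E v vM); apply: W.
Qed.

Lemma wins_aliceP M :
  reflect (M = setT \/ exists v, [/\ v \notin M, affordable M v &
                                     wins true (v |: M)])
          (wins false M).
Proof.
rewrite {2}/wins; case En: #|~: M| => [|n] /=.
  apply: ReflectT; left.
  by move/cards0_eq/(congr1 (@setC T)): En; rewrite setCK setC0.
have E v : v \notin M -> #|~: (v |: M)| = n.
  by move/card_unlisted; rewrite En => -[].
apply: (iffP exists_inP) => [[v vM /andP[av wv]]|[full|[v [vM av wv]]]].
- by right; exists v; rewrite /wins E.
- by move: En; rewrite full setCT cards0.
- by exists v => //; rewrite av -(E v vM).
Qed.

Lemma affordable_sub M v b : affordable (b |: M) v -> affordable M v.
Proof.
apply: leq_ltn_trans; apply: subset_leq_card; apply/subsetP => u.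
by rewrite !inE => /andP[-> ->]; rewrite orbT.
Qed.

Lemma safe_affordable M v : safe v -> affordable M v.
Proof.
apply: leq_ltn_trans; apply: subset_leq_card; apply/subsetP => u.
by rewrite !inE => /andP[].
Qed.

Hypothesis e_irr : irreflexive e.

(** Play on to the end: the last vertex is listed after all its neighbors, so
    its whole degree counts and is less than [s]. *)
Lemma wins_has_safe bob M :
  wins bob M -> M != setT -> exists2 b, b \notin M & safe b.
Proof.
move En: #|~: M| => n; elim: n bob M En => [|n IHn] bob M En wM MT.
  by move/cards0_eq/(congr1 (@setC T)): En MT; rewrite setCK setC0 => ->; rewrite eqxx.
have [v [vM av [bob' wv]]] : exists v, [/\ v \notin M, affordable M v &
    exists bob', wins bob' (v |: M)].
  case: bob wM => [/wins_bobP wM|/wins_aliceP[/eqP|[v [vM av wv]]]].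
  - have := MT; rewrite -subTset => /subsetPn[x _ xM].
    by have [ax wx] := wM x xM; exists x; split=> //; exists false.
  - by rewrite (negPf MT).
  - by exists v; split=> //; exists true.
have [full|] := eqVneq (v |: M) setT.
  exists v => //; apply: leq_ltn_trans av; apply: subset_leq_card.
  apply/subsetP => u; rewrite !inE => evu; rewrite evu andbT.
  have: u \in v |: M by rewrite full inE.
  by rewrite !inE; case: eqP evu => // ->; rewrite e_irr.
move: En; rewrite (card_unlisted vM) => -[/IHn IH] /(IH _ wv)[b].
by rewrite !inE negb_or => /andP[_ bM] sb; exists b.
Qed.

(** The two claims are proved together by induction on the number of unlisted
    vertices.  Removing [b] with Bob to move needs both claims for one more
    listed vertex, the second one when Bob answers with [b] itself; removing
    [b] with Alice to move needs only the first.  The second claim for [M]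
    follows from the first for the same [M]. *)
Lemma wins_remove_safe_and_skip n M : #|~: M| = n ->
  (forall bob b, b \notin M -> safe b -> wins bob (b |: M) -> wins bob M) /\
  (wins true M -> wins false M).
Proof.
elim: n M => [|n IHn] M En.
  move/cards0_eq/(congr1 (@setC T)): En; rewrite setCK setC0 => ->.
  by split=> [? ? |]; rewrite ?inE ?wins_setT.
have IH v : v \notin M -> #|~: (v |: M)| = n.
  by move=> vM; move: En; rewrite (card_unlisted vM) => -[].
have remove bob b : b \notin M -> safe b -> wins bob (b |: M) -> wins bob M.
  move=> bM sb; case: bob => [/wins_bobP|/wins_aliceP] wb.
    apply/wins_bobP => v vM; have [->|vb] := eqVneq v b.
      split; first exact: safe_affordable.
      by apply: (IHn _ (IH b bM)).2; apply/wins_bobP.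
    have [|av wv] := wb v; first by rewrite !inE negb_or vb.
    split; first exact: affordable_sub av.
    apply: (IHn _ (IH v vM)).1 sb _; first by rewrite !inE negb_or eq_sym vb.
    by rewrite setUCA.
  (* If [b] is the only unlisted vertex, Alice lists it; otherwise she makes
     the move she would make with [b] listed. *)
  apply/wins_aliceP; right; case: wb => [full|[a []]].
    exists b; split=> //; first exact: safe_affordable.
    by rewrite full wins_setT.
  rewrite !inE negb_or => /andP[ab aM] aa wa; exists a; split=> //.
    exact: affordable_sub aa.
  apply: (IHn _ (IH a aM)).1 sb _; first by rewrite !inE negb_or eq_sym ab.
  by rewrite setUCA.
split=> // wM; have [->|MT] := eqVneq M setT; first exact: wins_setT.
have [b bM sb] := wins_has_safe wM MT.
apply: (remove false b bM sb).
by have [_] := wins_bobP _ wM b bM.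
Qed.

Lemma wins_skip M : wins true M -> wins false M.
Proof. exact: (wins_remove_safe_and_skip (erefl _)).2. Qed.

(** For a partial list, the condition that the score is at most [s],
    restricted to the listed vertices. *)
Definition fair (t : seq T) : Prop :=
  forall v, v \in t -> #|Nplus_closed e t v| <= s.

(** Appending a vertex leaves the sets of earlier neighbors of all listed
    vertices unchanged, so the score can be checked move by move. *)
Lemma fair_rcons (t : seq T) v : v \notin t ->
  fair (rcons t v) <-> fair t /\ affordable [set u in t] v.
Proof.
move=> vt.
have old w : w \in t -> Nplus e (rcons t v) w = Nplus e t w.
  move=> wt; apply/setP => u; rewrite !inE -cats1 !index_cat wt.
  have [//|/memNindex->] := boolP (u \in t).
  by rewrite !ltnNge index_size (leq_trans (index_size w t) (leq_addr _ _)).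
have new : #|Nplus_closed e (rcons t v) v| = #|[set u in [set u in t] | e v u]|.+1.
  rewrite /Nplus_closed cardsU1 !inE ltnn andbF add1n; congr _.+1.
  apply: eq_card => u; rewrite !inE -cats1 !index_cat (negPf vt) /= eqxx addn0.
  by case: (boolP (u \in t)) => ut; rewrite andbC ?index_mem ?ut // ltnNge leq_addr.
split=> [ft|[ft av] w].
  split=> [w wt|]; last by rewrite /affordable -new ft // mem_rcons mem_head.
  by rewrite /Nplus_closed -old // ft // mem_rcons inE wt orbT.
rewrite mem_rcons inE => /predU1P[->|wt]; first by rewrite new.
by rewrite /Nplus_closed old // ft.
Qed.

Lemma fair_col (t : seq T) : (forall v, v \in t) -> fair t <-> col e t <= s.
Proof.
move=> full; split=> [ft|/bigmax_leqP ct v _]; last exact: ct.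
by apply/bigmax_leqP => v _; apply: ft.
Qed.

End Positions.

(** * Strategies with skips *)

Section Histories.

Variables (T : finType) (e : rel T) (s k l : nat).
Implicit Types (h : history T) (m : option T) (sigma : history T -> option T).

(** Legality of a history and obedience to a strategy have this common form, so
    one induction step serves both. *)
Lemma prefixes_rcons (P : history T -> option T -> Prop) h m :
  (forall i, i < size (rcons h m) ->
     P (take i (rcons h m)) (nth None (rcons h m) i)) <->
  (forall i, i < size h -> P (take i h) (nth None h i)) /\ P h m.
Proof.
have take_old i : i <= size h -> take i (rcons h m) = take i h.
  by move=> ih; rewrite -cats1 takel_cat.
split=> [Ph|[Ph Pm] i].
  split=> [i ih|].
    by have := Ph i; rewrite size_rcons nth_rcons ih take_old 1?ltnW //; apply.
  have := Ph (size h); rewrite size_rcons nth_rcons ltnn eqxx take_old //.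
  by rewrite take_size; apply.
rewrite size_rcons ltnS => ih; rewrite take_old // nth_rcons.
case: ltngtP ih => // [ih _|-> _]; [exact: Ph | by rewrite take_size].
Qed.

Lemma legal_rcons h m :
  legal_history k l (rcons h m) <-> legal_history k l h /\ legal_move k l h m.
Proof. exact: prefixes_rcons (fun h m => is_true (legal_move k l h m)) h m. Qed.

Lemma follows_rcons sigma h m :
  follows sigma (rcons h m) <->
  follows sigma h /\ (~~ bob_turn h -> m = sigma h).
Proof. exact: prefixes_rcons (fun h m => ~~ bob_turn h -> m = sigma h) h m. Qed.

Lemma bob_turn_rcons h m : bob_turn (rcons h m) = ~~ bob_turn h.
Proof. by rewrite /bob_turn size_rcons. Qed.

Definition listed h : {set T} := [set v in ordering h].

Lemma overE h : Defs.over h = (listed h == setT).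
Proof.
apply/forallP/eqP => [full|full v]; first by apply/setP => v; rewrite !inE full.
by have := in_setT v; rewrite -full inE.
Qed.

Lemma ordering_some h v : ordering (rcons h (Some v)) = rcons (ordering h) v.
Proof. by rewrite /ordering -!cats1 pmap_cat. Qed.

Lemma ordering_none h : ordering (rcons h None) = ordering h.
Proof. by rewrite /ordering -!cats1 pmap_cat cats0. Qed.

Lemma listed_nil : listed [::] = set0.
Proof. by apply/setP => v; rewrite !inE. Qed.

Lemma listed_some h v : listed (rcons h (Some v)) = v |: listed h.
Proof. by apply/setP => u; rewrite !inE ordering_some mem_rcons inE. Qed.

Lemma listed_none h : listed (rcons h None) = listed h.
Proof. by rewrite /listed ordering_none. Qed.

Hypothesis e_irr : irreflexive e.

(** Every history in which Alice obeys the strategy can be continued to the end,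
    where the score is at most [s]; reading this backwards shows that all the
    positions on the way are winning, and [wins_skip] turns a skip by Alice
    into a move.  The continuation never lets Bob skip. *)
Lemma guarantees_wins : alice_guarantees e k l s -> wins e s false set0.
Proof.
case=> sigma legal_sigma score.
suff main n h : #|~: listed h| = n -> legal_history k l h ->
    follows sigma h ->
    fair e s (ordering h) /\ wins e s (bob_turn h) (listed h).
  by rewrite -listed_nil; apply: (main _ [::] (erefl _) _ _).2.
(* The induction is on the number of unlisted vertices.  A skip by Alice does
   not lower it, but the next move is a move of Bob, which does; therefore
   Bob's turns, for all histories [g] with the listed vertices of [h], come
   before Alice's. *)
elim: n h => [|n IHn] h En lh fh.
  have full : listed h = setT.
    by move/cards0_eq/(congr1 (@setC T)): En; rewrite setCK setC0.
  rewrite full wins_setT; split=> //.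
  have oh : Defs.over h by rewrite overE full.
  by apply/fair_col; [exact/forallP | exact: score].
have not_over : ~~ Defs.over h.
  by rewrite overE; apply/eqP => full; move: En; rewrite full setCT cards0.
have listing g v : legal_history k l g -> follows sigma g ->
    listed g = listed h -> v \notin listed h ->
    (~~ bob_turn g -> sigma g = Some v) ->
    [/\ fair e s (ordering g), affordable e s (listed h) v &
        wins e s (~~ bob_turn g) (v |: listed h)].
  move=> lg fg gh vh gv.
  have vg : v \notin ordering g by move: vh; rewrite -gh inE.
  have cg : #|~: listed (rcons g (Some v))| = n.
    by rewrite listed_some gh; move: En; rewrite (card_unlisted vh) => -[].
  have lgv : legal_history k l (rcons g (Some v)).
    by apply/legal_rcons; split=> //; rewrite /legal_move overE gh -overE not_over.
  have fgv : follows sigma (rcons g (Some v)).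
    by apply/follows_rcons; split=> // /gv.
  have := IHn _ cg lgv fgv.
  rewrite ordering_some bob_turn_rcons listed_some gh => -[fr wg].
  by have [fo] := (fair_rcons e s vg).1 fr; rewrite -/(listed g) gh.
have bob_wins g : legal_history k l g -> follows sigma g ->
    listed g = listed h -> bob_turn g ->
    fair e s (ordering g) /\ wins e s true (listed h).
  move=> lg fg gh bg.
  have all_moves v : v \notin listed h -> _ :=
    fun vh => listing g v lg fg gh vh (fun nb => False_ind _ (negP nb bg)).
  split.
    have [v vh] : exists v, v \notin listed h.
      by move: not_over; rewrite overE -subTset => /subsetPn[v _]; exists v.
    by have [] := all_moves v vh.
  by apply/wins_bobP => v /all_moves[_ av]; rewrite bg.
have [bh|ah] := boolP (bob_turn h); first exact: bob_wins.
have := legal_sigma h lh not_over ah; case Em: (sigma h) => [v|] legal_m.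
  have vh : v \notin listed h by move: legal_m; rewrite /legal_move not_over inE.
  have [//|fo av wv] := listing h v lh fh (erefl _) vh; rewrite ah in wv.
  by split=> //; apply/wins_aliceP; right; exists v.
have [||||fo wh] // := bob_wins (rcons h None).
- by apply/legal_rcons; split.
- by apply/follows_rcons; split.
- exact: listed_none.
- by rewrite bob_turn_rcons.
by rewrite ordering_none in fo; split=> //; apply: wins_skip.
Qed.

(** From a lost position the vertex is arbitrary: a strategy must move legally
    even after histories that it would not have produced. *)
Definition keep_winning h : option T :=
  if [pick v | [&& v \notin listed h, affordable e s (listed h) v &
                   wins e s true (v |: listed h)]] is Some v
  then Some v else [pick v | v \notin listed h].

(** Along the play Alice stays in winning positions; if Bob skips, she stays in
    one by [wins_skip]. *)
Lemma wins_guarantees : wins e s false set0 -> alice_guarantees e k l s.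
Proof.
move=> w0; exists keep_winning => [h _ not_over _|h lh oh fh].
  rewrite /legal_move not_over /keep_winning.
  case: pickP => [v /and3P[]|_]; first by rewrite inE.
  case: pickP => [v|full]; first by rewrite inE.
  case/negP: not_over; rewrite overE; apply/eqP/setP => v.
  by rewrite in_setT; move/negbFE: (full v).
apply/(fair_col e s); first exact/forallP.
suff [] : fair e s (ordering h) /\ wins e s (bob_turn h) (listed h) by [].
elim/last_ind: h lh fh {oh} => [_ _|h m IHh].
  by split=> [v|]; rewrite ?in_nil // listed_nil.
case/legal_rcons => lh legal_m /follows_rcons[fh m_sigma].
have [fo wh] := IHh lh fh; case/andP: legal_m => not_over legal_m.
rewrite bob_turn_rcons.
have append v : v \notin listed h -> affordable e s (listed h) v ->
    wins e s (~~ bob_turn h) (v |: listed h) ->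
    fair e s (ordering (rcons h (Some v))) /\
    wins e s (~~ bob_turn h) (listed (rcons h (Some v))).
  move=> vh av wv; rewrite ordering_some listed_some; split=> //.
  by apply/(fair_rcons e s); [rewrite inE in vh | split].
have [bh|ah] := boolP (bob_turn h); last first.
  rewrite (m_sigma ah) /keep_winning; rewrite (negPf ah) in wh append.
  case: pickP => [v /and3P[vh av wv]|lost]; first exact: append.
  case/wins_aliceP: wh => [full|[v [vh av wv]]].
    by move: not_over; rewrite overE full eqxx.
  by have := lost v; rewrite vh av wv.
rewrite bh in wh append; case: m legal_m {m_sigma} => [v vh|_].
  have {}vh : v \notin listed h by rewrite inE.
  by have [av wv] := wins_bobP _ _ _ wh v vh; apply: append.
by rewrite ordering_none listed_none; split=> //; apply: wins_skip.
Qed.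

End Histories.

Lemma gcol_skip_le (T : finType) (e : rel T) (k l k' l' : nat) :
  irreflexive e -> gcol_skip e k l <= gcol_skip e k' l'.
Proof.
move=> e_irr; rewrite /gcol_skip.
case: ex_minnP => a _ least; case: ex_minnP => b gb _.
apply: least; apply/asboolP; apply: wins_guarantees => //.
by move/asboolP: gb => gb; apply: guarantees_wins gb.
Qed.

Theorem mainTheorem2 (T : finType) (e : rel T)
    (e_sym : symmetric e) (e_irr : irreflexive e) :
  (forall k : nat, gcol e <= gcol_skip e k 0) /\
  (forall l : nat, gcol_skip e 0 l <= gcol e).
Proof. by split=> ?; apply: gcol_skip_le. Qed.
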